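(* Let $(R_1,\mathcal L_1)$ and $(R_2,\mathcal L_2)$ be recursive rings with a recursive interpretation of a language. Let $\phi:R_1\to R_2$ be a bijective recursive function. Suppose that $d:R_1\to R_2$ is given by a Diophantine expression in $\phi$. Then $d$ is a recursive function.
   Context: A recursive ring is a ring $R$ with a fixed recursive representation, i.e. an injection $j:R\to\mathbb N$ with recursive image for which addition and multiplication are recursive; subsets of $R^k$ are recursive if their images under $j^k$ are, and a function $R_1\to R_2$ is recursive if its translation $j_2\circ f\circ j_1^{-1}$ is the restriction of a recursive function. A language $\mathcal L$ (constants, functions, relations; always containing a constant $0$ and equality) has a recursive interpretation in $R$ if all its functions are interpreted by recursive functions and all its relations by recursive sets. Terms are built from constants and variables using functions of $\mathcal L$; basic formulas are $(t_1,\ldots,t_k)\in R'$ with $R'\in\mathcal L$ a $k$-ary relation (possibly equality). A map $d:R_1\to R_2$ is given by a Diophantine expression in $\phi:R_1\to R_2$ if there are basic $\mathcal L_2$-formulas $f_1,\ldots,f_n$ and an $l$ such that for all $x\in R_1$, $z\in R_2$: $d(x)=z\iff\exists\vec y\in R_2^{l},\ \forall1\le i\le n,\ f_i(\phi(x),\vec y,z)$. *)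

(* Defs.v *)
From mathcomp Require Import all_boot all_algebra.

Set Implicit Arguments.
Unset Strict Implicit.
Unset Printing Implicit Defensive.

Import GRing.Theory.
Local Open Scope ring_scope.

(* Syntax of the k-ary partial (mu-)recursive functions. *)
Inductive recalg : nat -> Type :=
| RZero : recalg 0
| RSucc : recalg 1
| RProj k of 'I_k : recalg k
| RComp k m of recalg m & ('I_m -> recalg k) : recalg k
| RPrec k of recalg k & recalg k.+2 : recalg k.+1
| RMin k of recalg k.+1 : recalg k.

(* [receval f v y]: the partial function denoted by [f] is defined at [v],
   with value [y].  Primitive recursion and minimization act on the first
   argument; the step function of a primitive recursion takes the counter, the
   previous value and the parameters, in that order. *)
Fixpoint receval k (f : recalg k) : k.-tuple nat -> nat -> Prop :=
  match f with
  | RZero => fun _ y => y = 0%N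
  | RSucc => fun v y => y = (thead v).+1
  | RProj _ i => fun v y => y = tnth v i
  | RComp _ m g h => fun v y =>
      exists2 w : m.-tuple nat,
        (forall i, receval (h i) v (tnth w i)) & receval g w y
  | RPrec k g h => fun v =>
      let p : k.-tuple nat := [tuple of behead v] in
      (fix loop n : nat -> Prop :=
         if n is n'.+1 then
           fun y => exists2 z, loop n' z & receval h [tuple of n' :: z :: p] y
         else receval g p) (thead v)
  | RMin _ g => fun v y =>
      receval g [tuple of y :: v] 0%N /\
      (forall z, (z < y)%N -> exists t, receval g [tuple of z :: v] t.+1)
  end.

Definition recursive_fun k (F : k.-tuple nat -> nat) : Prop :=
  exists f : recalg k, forall v y, receval f v y <-> y = F v.

Definition recursive_set k (S : k.-tuple nat -> Prop) : Prop :=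
  exists2 chi : k.-tuple nat -> bool,
    recursive_fun (fun v => nat_of_bool (chi v)) & forall v, S v <-> chi v.

(* j2 \o f \o (j1^k)^-1 is the restriction of a recursive function. *)
Definition recursive_op (T1 T2 : Type) (j1 : T1 -> nat) (j2 : T2 -> nat)
    k (f : k.-tuple T1 -> T2) : Prop :=
  exists2 F : k.-tuple nat -> nat,
    recursive_fun F & forall v, F (map_tuple j1 v) = j2 (f v).

Definition recursive_map (T1 T2 : Type) (j1 : T1 -> nat) (j2 : T2 -> nat)
    (f : T1 -> T2) : Prop :=
  recursive_op j1 j2 (fun v : 1.-tuple T1 => f (thead v)).

Definition recursive_subset (T : Type) (j : T -> nat)
    k (S : k.-tuple T -> Prop) : Prop :=
  recursive_set (fun w : k.-tuple nat => exists2 v, S v & w = map_tuple j v).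

Record recursive_representation (R : pzRingType) := RecursiveRepresentation {
  code :> R -> nat;
  code_inj : injective code;
  code_image : recursive_set (fun w : 1.-tuple nat => exists x, thead w = code x);
  code_add :
    recursive_op code code (fun v : 2.-tuple R => tnth v ord0 + tnth v ord_max);
  code_mul :
    recursive_op code code (fun v : 2.-tuple R => tnth v ord0 * tnth v ord_max)
}.

(* Function and relation symbols are indexed by their arity. *)
Record language := Language {
  constant : Type;
  function : nat -> Type;
  relation : nat -> Type;
  zero_symbol : constant;
  eq_symbol : relation 2
}.

Record interpretation (L : language) (R : pzRingType) := Interpretation {
  iconst : constant L -> R;
  ifun : forall k, function L k -> k.-tuple R -> R;
  irel : forall k, relation L k -> k.-tuple R -> Prop;
  iconst_zero : iconst (zero_symbol L) = 0;
  irel_eq : forall v, irel (eq_symbol L) v <-> tnth v ord0 = tnth v ord_max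
}.

Definition recursive_interpretation (L : language) (R : pzRingType)
    (j : recursive_representation R) (I : interpretation L R) : Prop :=
  (forall k (g : function L k), recursive_op j j (ifun I g)) /\
  (forall k (r : relation L k), recursive_subset j (irel I r)).

Inductive term (L : language) (n : nat) : Type :=
| Var of 'I_n
| Const of constant L
| App k of function L k & ('I_k -> term L n).

Inductive basic_formula (L : language) (n : nat) : Type :=
| Basic k of relation L k & ('I_k -> term L n).

Fixpoint teval (L : language) (R : pzRingType) (I : interpretation L R)
    n (e : n.-tuple R) (t : term L n) : R :=
  match t with
  | Var i => tnth e i
  | Const c => iconst I c
  | App k g ts => ifun I g [tuple teval I e (ts i) | i < k]
  end.

Definition holds (L : language) (R : pzRingType) (I : interpretation L R)
    n (f : basic_formula L n) (e : n.-tuple R) : Prop :=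
  let: Basic k r ts := f in irel I r [tuple teval I e (ts i) | i < k].

(* The l + 2 variables stand, in order, for phi x, y_1, ..., y_l and z. *)
Definition diophantine_expression (R1 R2 : pzRingType) (L2 : language)
    (I2 : interpretation L2 R2) (phi d : R1 -> R2) : Prop :=
  exists (n l : nat) (f : 'I_n -> basic_formula L2 l.+2),
    forall (x : R1) (z : R2),
      d x = z <->
      exists y : l.-tuple R2,
        forall i, holds I2 (f i) [tuple of phi x :: rcons y z].

(* Main.v *)
Require Import Defs.
From mathcomp Require Import all_boot all_algebra.

Set Implicit Arguments.
Unset Strict Implicit.
Unset Printing Implicit Defensive.

(** The graph of [d], read on codes, is the projection of a recursive relation:
    [d x = z] holds iff some [y] satisfies the basic formulas at
    [phi x, y, z], and whether given codes satisfy them is decidable because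
    terms evaluate to recursive functions of the codes ([recursive_op_teval])
    and relation symbols denote recursive sets ([recursive_subset_holds]).
    As [d] is total, an unbounded search through all candidates [(y, z)] halts
    on every code of an element of [R1], and the [z] that it finds is the code
    of [d x] because no other [z] admits a witness.

    A function counts as recursive here only if it is total on tuples of
    naturals, so the search must also halt on inputs that are not codes.  It
    does since the image of the coding of [R1] is recursive: on an input outside
    it, every candidate is accepted.

    The search itself is [recursive_selection].  It needs no coding of tuples:
    minimization yields a bound below which all components of some solution
    lie, quantification below a bound preserves recursive sets
    ([recursive_set_bounded_exists]), and a second minimization yields [z]. *)

(** * Recursive functions *)

Lemma recursive_fun_ext k (F G : k.-tuple nat -> nat) :
  F =1 G -> recursive_fun F -> recursive_fun G.
Proof. by move=> FG [f fP]; exists f => v y; rewrite -FG; apply: fP. Qed.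

Lemma recursive_proj k (i : 'I_k) : recursive_fun (fun v => tnth v i).
Proof. by exists (RProj i). Qed.

(** Tuple-valued functions with recursive components: the inner functions of
    a composition. *)
Definition recursive_tuple k m (g : k.-tuple nat -> m.-tuple nat) : Prop :=
  forall i, recursive_fun (fun v => tnth (g v) i).

(** Only finitely many inner programs have to be chosen, so no choice axiom is
    involved. *)
Lemma recursive_comp k m (G : m.-tuple nat -> nat)
    (g : k.-tuple nat -> m.-tuple nat) :
  recursive_fun G -> recursive_tuple g -> recursive_fun (fun v => G (g v)).
Proof.
move=> [f fP] /fin_all_exists[h hP]; exists (RComp f h) => v y /=; split.
  case=> w hw /fP->; congr G; apply: eq_from_tnth => i.
  by apply/hP; apply: hw.
by move=> ->; exists (g v) => [i|]; [apply/hP | apply/fP].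
Qed.

Lemma recursive_tuple_id k : recursive_tuple (fun v : k.-tuple nat => v).
Proof. by move=> i; apply: recursive_proj. Qed.

Lemma recursive_tuple_nil k : recursive_tuple (fun _ : k.-tuple nat => [tuple]).
Proof. by case. Qed.

Lemma recursive_tuple_cons k m (F : k.-tuple nat -> nat)
    (g : k.-tuple nat -> m.-tuple nat) :
  recursive_fun F -> recursive_tuple g ->
  recursive_tuple (fun v => [tuple of F v :: g v]).
Proof.
move=> rF rg i; case: (unliftP ord0 i) => [j|] ->.
  by apply: recursive_fun_ext (rg j) => v; rewrite tnthS.
by apply: recursive_fun_ext rF => v; rewrite tnth0.
Qed.

Lemma tnth_behead_lift (T : Type) n (t : n.+1.-tuple T) (i : 'I_n) :
  tnth [tuple of behead t] i = tnth t (lift ord0 i).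
Proof.
rewrite tnth_behead; congr (tnth _ _); apply: val_inj.
by rewrite /= inordK // ltnS.
Qed.

Lemma recursive_tuple_behead k m (g : k.-tuple nat -> m.+1.-tuple nat) :
  recursive_tuple g -> recursive_tuple (fun v => [tuple of behead (g v)]).
Proof.
move=> rg i; apply: recursive_fun_ext (rg (lift ord0 i)) => v.
by rewrite tnth_behead_lift.
Qed.

Lemma recursive_tuple_cat k m n (g : k.-tuple nat -> m.-tuple nat)
    (h : k.-tuple nat -> n.-tuple nat) :
  recursive_tuple g -> recursive_tuple h ->
  recursive_tuple (fun v => [tuple of g v ++ h v]).
Proof.
move=> rg rh i; case: (split_ordP i) => j ->.
  by apply: recursive_fun_ext (rg j) => v; rewrite tnth_lshift.
by apply: recursive_fun_ext (rh j) => v; rewrite tnth_rshift.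
Qed.

Lemma recursive_tuple_rcons k m (g : k.-tuple nat -> m.-tuple nat)
    (F : k.-tuple nat -> nat) :
  recursive_tuple g -> recursive_fun F ->
  recursive_tuple (fun v => [tuple of rcons (g v) (F v)]).
Proof.
move=> rg rF i; have := ltn_ord i; rewrite ltnS leq_eqVlt => /orP[/eqP im|im].
  apply: recursive_fun_ext rF => v.
  by rewrite (tnth_nth 0) /= nth_rcons size_tuple im ltnn eqxx.
apply: recursive_fun_ext (rg (Ordinal im)) => v.
by rewrite !(tnth_nth 0) /= nth_rcons size_tuple im.
Qed.

Lemma recursive_tuple_mktuple k m (F : 'I_m -> k.-tuple nat -> nat) :
  (forall i, recursive_fun (F i)) ->
  recursive_tuple (fun v => [tuple F i v | i < m]).
Proof.
by move=> rF i; apply: recursive_fun_ext (rF i) => v; rewrite tnth_mktuple.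
Qed.

Lemma recursive_succ k (F : k.-tuple nat -> nat) :
  recursive_fun F -> recursive_fun (fun v => (F v).+1).
Proof.
move=> rF; have rS : recursive_fun (fun v : 1.-tuple nat => (thead v).+1).
  by exists RSucc.
exact: recursive_comp rS (recursive_tuple_cons rF (@recursive_tuple_nil k)).
Qed.

Lemma recursive_const k c : recursive_fun (fun _ : k.-tuple nat => c).
Proof.
elim: c => [|c IHc]; last exact: recursive_succ.
have r0 : recursive_fun (fun _ : 0.-tuple nat => 0) by exists RZero.
exact: recursive_comp r0 (@recursive_tuple_nil k).
Qed.

(** Primitive recursion on the first argument, for a function given by its
    recursion equations. *)
Lemma recursive_prec k (G : k.-tuple nat -> nat) (H : k.+2.-tuple nat -> nat)
    (F : k.+1.-tuple nat -> nat) :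
    recursive_fun G -> recursive_fun H ->
    (forall p : k.-tuple nat, F [tuple of 0 :: p] = G p) ->
    (forall n (p : k.-tuple nat), F [tuple of n.+1 :: p] =
                 H [tuple of n :: F [tuple of n :: p] :: p]) ->
  recursive_fun F.
Proof.
move=> [g gP] [h hP] F0 FS; exists (RPrec g h) => v y.
pose iterate p := fix loop n : nat -> Prop :=
  if n is n'.+1 then
    fun y => exists2 z, loop n' z & receval h [tuple of n' :: z :: p] y
  else receval g p.
have iterateP (p : k.-tuple nat) n x : iterate p n x <-> x = F [tuple of n :: p].
  elim: n x => [|n IHn] x /=; first by rewrite F0; apply: gP.
  rewrite FS; split=> [[z /IHn-> /hP] //|->].
  by exists (F [tuple of n :: p]); [apply/IHn | apply/hP].
have -> : F v = F [tuple of thead v :: [tuple of behead v]].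
  by congr F; apply: tuple_eta.
exact: iterateP.
Qed.

(** Definition by cases; a test value counts as true when it is nonzero. *)
Lemma recursive_if k (C A B : k.-tuple nat -> nat) :
  recursive_fun C -> recursive_fun A -> recursive_fun B ->
  recursive_fun (fun v => if C v == 0 then B v else A v).
Proof.
move=> rC rA rB.
(* a recursion that ignores the previous value *)
pose F (u : 3.-tuple nat) :=
  if thead u == 0 then tnth u (inord 2) else tnth u (inord 1).
have rF : recursive_fun F.
  apply: (@recursive_prec 2 (fun p => tnth p ord_max)
    (fun p => tnth p (inord 2))).
  - exact: recursive_proj.
  - exact: recursive_proj.
  - by move=> p; rewrite /F theadE /= !(tnth_nth 0) /= inordK.
  - by move=> n p; rewrite /F theadE /= !(tnth_nth 0) /= !inordK.
have rT := recursive_tuple_cons rC (recursive_tuple_cons rA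
  (recursive_tuple_cons rB (@recursive_tuple_nil k))).
apply: recursive_fun_ext (recursive_comp rF rT) => v.
by rewrite /F theadE !(tnth_nth 0) /= !inordK.
Qed.

(** * Recursive sets *)

Lemma recursive_set_ext k (S T : k.-tuple nat -> Prop) :
  (forall v, S v <-> T v) -> recursive_set S -> recursive_set T.
Proof.
move=> ST [chi rchi chiP]; exists chi => // v.
by split=> [/ST/chiP | /chiP/ST].
Qed.

Lemma recursive_set_preimage k m (S : m.-tuple nat -> Prop)
    (g : k.-tuple nat -> m.-tuple nat) :
  recursive_set S -> recursive_tuple g -> recursive_set (fun v => S (g v)).
Proof.
by move=> [chi rchi chiP] rg; exists (fun v => chi (g v)) => //;
   apply: recursive_comp rchi rg.
Qed.

Lemma recursive_setT k : recursive_set (fun _ : k.-tuple nat => True).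
Proof. by exists xpredT => //; apply: recursive_const. Qed.

Lemma recursive_setC k (S : k.-tuple nat -> Prop) :
  recursive_set S -> recursive_set (fun v => ~ S v).
Proof.
move=> [chi rchi chiP]; exists (fun v => ~~ chi v) => [|v].
  apply: recursive_fun_ext (recursive_if rchi (recursive_const k 0)
    (recursive_const k 1)) => v.
  by case: (chi v).
split=> [NSv | /negP Nchiv /chiP //]; first by apply/negP => /chiP.
Qed.

Lemma recursive_setI k (S T : k.-tuple nat -> Prop) :
  recursive_set S -> recursive_set T -> recursive_set (fun v => S v /\ T v).
Proof.
move=> [chi rchi chiP] [psi rpsi psiP].
exists (fun v => chi v && psi v) => [|v].
  apply: recursive_fun_ext (recursive_if rchi rpsi (recursive_const k 0)) => v.
  by case: (chi v).
by split=> [[/chiP-> /psiP->] | /andP[/chiP ? /psiP ?]].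
Qed.

Lemma recursive_setU k (S T : k.-tuple nat -> Prop) :
  recursive_set S -> recursive_set T -> recursive_set (fun v => S v \/ T v).
Proof.
move=> [chi rchi chiP] [psi rpsi psiP].
exists (fun v => chi v || psi v) => [|v].
  apply: recursive_fun_ext (recursive_if rchi (recursive_const k 1) rpsi) => v.
  by case: (chi v).
by split=> [[/chiP-> | /psiP->] | /orP[/chiP|/psiP]]; rewrite ?orbT; auto.
Qed.

Lemma recursive_set_forall k n (S : 'I_n -> k.-tuple nat -> Prop) :
  (forall i, recursive_set (S i)) -> recursive_set (fun v => forall i, S i v).
Proof.
elim: n S => [|n IHn] S rS.
  by apply: recursive_set_ext (recursive_setT k) => v; split=> // _ [].
apply: recursive_set_ext
  (recursive_setI (rS ord0) (IHn _ (fun i => rS (lift ord0 i)))) => v.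
by split=> [[S0 SS] i | SS]; [case: (unliftP ord0 i) => [j|] -> | split].
Qed.

(** The bounded disjunction is computed by primitive recursion on the bound. *)
Lemma recursive_set_bounded_exists k (S : k.+1.-tuple nat -> Prop)
    (B : k.-tuple nat -> nat) :
  recursive_set S -> recursive_fun B ->
  recursive_set (fun v => exists2 n, n < B v & S [tuple of n :: v]).
Proof.
move=> [chi rchi chiP] rB.
pose e (p : k.-tuple nat) b := has (fun n => chi [tuple of n :: p]) (iota 0 b).
have eS p b : e p b.+1 = e p b || chi [tuple of b :: p].
  by rewrite /e -[b.+1]addn1 iotaD cats1 has_rcons orbC.
pose E (u : k.+1.-tuple nat) := e [tuple of behead u] (thead u).
have EE (p : k.-tuple nat) b : E [tuple of b :: p] = e p b.
  by congr e; apply: val_inj.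
have rE : recursive_fun (fun u => nat_of_bool (E u)).
  pose H (u : k.+2.-tuple nat) := if tnth u (lift ord0 ord0) == 0
    then nat_of_bool (chi [tuple of thead u :: behead (behead u)])
    else 1.
  apply: (@recursive_prec k (fun=> 0) H); first exact: recursive_const.
  - apply: recursive_if (recursive_const _ 1) _; first exact: recursive_proj.
    apply: recursive_comp rchi _; apply: recursive_tuple_cons.
      exact: recursive_proj.
    exact/recursive_tuple_behead/recursive_tuple_behead/recursive_tuple_id.
  - by move=> p; rewrite EE.
  move=> n p; rewrite !EE eS /H tnthS tnth0 theadE.
  by case: (e p n) => //=; congr (nat_of_bool (chi _)); apply: val_inj.
exists (fun v => E [tuple of B v :: v]).
  exact: recursive_comp rE (recursive_tuple_cons rB (@recursive_tuple_id k)).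
move=> v; rewrite EE; split=> [[n ltn /chiP Sn] | /hasP[n]].
  by apply/hasP; exists n => //; rewrite mem_iota.
by rewrite mem_iota => ltn Sn; exists n => //; apply/chiP.
Qed.

Lemma recursive_set_bounded_exists_tuple l k (S : (l + k).-tuple nat -> Prop)
    (B : k.-tuple nat -> nat) :
  recursive_set S -> recursive_fun B ->
  recursive_set (fun v => exists2 y : l.-tuple nat,
    all (fun n => n < B v) y & S [tuple of y ++ v]).
Proof.
elim: l S => [|l IHl] S rS rB.
  apply: recursive_set_ext rS => v; have catE : [tuple of [tuple] ++ v] = v.
    exact: val_inj.
  by split=> [Sv | [y _]]; [exists [tuple]; rewrite ?catE | rewrite tuple0 catE].
(* the parameters, once l variables have been put in front of them *)
pose drp (u : (l + k).-tuple nat) := [tuple tnth u (rshift l i) | i < k].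
have drpE (y : l.-tuple nat) (v : k.-tuple nat) : drp [tuple of y ++ v] = v.
  by apply: eq_from_tnth => i; rewrite tnth_mktuple tnth_rshift.
have rD : recursive_fun (fun u => B (drp u)).
  by apply: recursive_comp rB _; apply: recursive_tuple_mktuple => i;
     apply: recursive_proj.
apply: recursive_set_ext (IHl _ (recursive_set_bounded_exists rS rD) rB) => v.
split=> [[y yB [n]] | [y]].
  rewrite drpE => nB Sn; exists [tuple of n :: y]; first by rewrite /= nB.
  by congr S: Sn; apply: val_inj.
case/tupleP: y => n y /= /andP[nB yB] Sn; exists y => //; exists n.
  by rewrite drpE.
by congr S: Sn; apply: val_inj.
Qed.

(** * Unbounded search *)

(** Minimization over a set all of whose sections are nonempty is total, and
    it selects an element of each section. *)
Lemma recursive_min k (S : k.+1.-tuple nat -> Prop) :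
  recursive_set S -> (forall v : k.-tuple nat, exists n, S [tuple of n :: v]) ->
  exists2 F : k.-tuple nat -> nat,
    recursive_fun F & forall v, S [tuple of F v :: v].
Proof.
(* minimization looks for a zero, so the program tests the complement *)
move=> rS; have [psi [g gP] psiP] := recursive_setC rS.
case: rS => chi _ chiP exS.
have exchi (v : k.-tuple nat) : exists n, chi [tuple of n :: v].
  by have [n /chiP] := exS v; exists n.
have psiE u : psi u = ~~ chi u.
  by apply/idP/negP => [/psiP NS /chiP | Nchi]; last by apply/psiP => /chiP.
exists (fun v => ex_minn (exchi v)); last first.
  by move=> v; apply/chiP; case: ex_minnP.
exists (RMin g) => v y /=; case: ex_minnP => m chim minm; split=> [[gy ltgy]|->].
  apply/eqP; rewrite eqn_leq [m <= y]minm; last first.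
    by move/gP: gy; rewrite psiE; case: (chi _).
  rewrite andbT leqNgt; apply/negP => /ltgy[t /gP].
  by rewrite psiE chim.
split=> [|n ltnm]; first by apply/gP; rewrite psiE chim.
exists 0; apply/gP; rewrite psiE; case: (boolP (chi _)) => // /minm.
by rewrite leqNgt ltnm.
Qed.

(** A recursive function can select, for every [v], a value [z] for which some
    [y] satisfies the recursive condition [S].  If [z] is unique, this says that
    a total function with recursively enumerable graph is recursive. *)
Lemma recursive_selection l k (S : (l + k.+1).-tuple nat -> Prop) :
    recursive_set S ->
    (forall v : k.-tuple nat, exists (y : l.-tuple nat) (z : nat),
      S [tuple of y ++ [tuple of z :: v]]) ->
  exists2 F : k.-tuple nat -> nat, recursive_fun F &
    forall v, exists y : l.-tuple nat, S [tuple of y ++ [tuple of F v :: v]].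
Proof.
move=> rS exS.
(* The first argument of U is a bound on y; the others are z and v. *)
pose U (w : k.+2.-tuple nat) := exists2 y : l.-tuple nat,
  all (fun n => n < thead w) y & S [tuple of y ++ [tuple of behead w]].
have rU : recursive_set U.
  pose S' (u : (l + k.+2).-tuple nat) :=
    S [tuple of [tuple tnth u (lshift k.+2 i) | i < l] ++
      [tuple tnth u (rshift l (lift ord0 i)) | i < k.+1]].
  have rS' : recursive_set S'.
    apply: recursive_set_preimage rS _.
    by apply: recursive_tuple_cat; apply: recursive_tuple_mktuple => i;
       apply: recursive_proj.
  have rB : recursive_fun (fun w : k.+2.-tuple nat => thead w).
    exact: recursive_proj.
  apply: recursive_set_ext (recursive_set_bounded_exists_tuple rS' rB) => w.
  have S'E (y : l.-tuple nat) :
      S' [tuple of y ++ w] = S [tuple of y ++ [tuple of behead w]].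
    congr S; congr cat_tuple; apply: eq_from_tnth => i.
      by rewrite tnth_mktuple tnth_lshift.
    by rewrite tnth_mktuple tnth_rshift tnth_behead_lift.
  by split=> -[y yB]; [rewrite S'E | rewrite -S'E]; exists y.
have UE b z (v : k.-tuple nat) : U [tuple of b :: [tuple of z :: v]] <->
    exists2 y : l.-tuple nat, all (fun n => n < b) y &
      S [tuple of y ++ [tuple of z :: v]].
  rewrite /U theadE.
  by have -> : [tuple of behead [tuple of b :: [tuple of z :: v]]]
     = [tuple of z :: v] by apply: val_inj.
(* The first argument of V bounds both y and z, so that V is recursive. *)
pose V (w : k.+1.-tuple nat) := exists2 z, z < thead w &
  U [tuple of thead w :: [tuple of z :: [tuple of behead w]]].
have rV : recursive_set V.
  pose U' (w : k.+2.-tuple nat) := U [tuple of tnth w (inord 1) ::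
     [tuple of thead w :: [tuple of behead [tuple of behead w]]]].
  have rU' : recursive_set U'.
    apply: recursive_set_preimage rU _.
    apply: recursive_tuple_cons; first exact: recursive_proj.
    apply: recursive_tuple_cons; first exact: recursive_proj.
    exact/recursive_tuple_behead/recursive_tuple_behead/recursive_tuple_id.
  have rB : recursive_fun (fun w : k.+1.-tuple nat => thead w).
    exact: recursive_proj.
  apply: recursive_set_ext (recursive_set_bounded_exists rU' rB) => w.
  have U'E z : U' [tuple of z :: w] =
      U [tuple of thead w :: [tuple of z :: [tuple of behead w]]].
    rewrite /U'; congr U; apply: val_inj => /=.
    rewrite !(tnth_nth 0) /= inordK //.
    by rewrite /thead !(tnth_nth 0) /=.
  by split=> -[z zB]; [rewrite U'E | rewrite -U'E]; exists z.
have VE b (v : k.-tuple nat) : V [tuple of b :: v] <->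
    exists2 z, z < b & U [tuple of b :: [tuple of z :: v]].
  rewrite /V theadE.
  by have -> : [tuple of behead [tuple of b :: v]] = v by apply: val_inj.
have exV (v : k.-tuple nat) : exists b, V [tuple of b :: v].
  have [y [z Syz]] := exS v; exists (maxn z (\max_(n <- y) n)).+1.
  apply/VE; exists z; first by rewrite ltnS leq_maxl.
  apply/UE; exists y => //; apply/allP => n ny.
  by rewrite ltnS leq_max (@leq_bigmax_seq _ _ xpredT id n) ?orbT.
(* B v bounds some solution; a z that has a witness y below B v is
   then found by a second minimization. *)
have [B rB BP] := recursive_min rV exV.
have rUB : recursive_set (fun w : k.+1.-tuple nat =>
    U [tuple of B [tuple of behead w] :: w]).
  apply: recursive_set_preimage rU _; apply: recursive_tuple_cons.
    apply: recursive_comp rB _.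
    exact/recursive_tuple_behead/recursive_tuple_id.
  exact: recursive_tuple_id.
have beheadE z (v : k.-tuple nat) : [tuple of behead [tuple of z :: v]] = v.
  exact: val_inj.
have [v|F rF FP] := recursive_min rUB.
  by have /VE[z _ Uz] := BP v; exists z; rewrite beheadE.
exists F => // v; have := FP v; rewrite beheadE => /UE[y _ Sy].
by exists y.
Qed.

(** * Terms and basic formulas on codes *)

Lemma recursive_op_teval (L : language) (R : pzRingType)
    (j : recursive_representation R) (I : interpretation L R) n (t : term L n) :
  recursive_interpretation j I -> recursive_op j j (fun e => teval I e t).
Proof.
case=> rfun _; elim: t => [i|c|k g ts IHts].
- exists (fun v => tnth v i) => [|v]; first exact: recursive_proj.
  by rewrite tnth_map.
- by exists (fun=> j (iconst I c)); first exact: recursive_const.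
have [G rG GP] := rfun _ g.
have /fin_all_exists[F FP] : forall i, exists F, recursive_fun F /\
    forall e, F (map_tuple j e) = j (teval I e (ts i)).
  by move=> i; have [F rF FP] := IHts i; exists F.
exists (fun v => G [tuple F i v | i < k]) => [|e].
  apply: recursive_comp rG _; apply: recursive_tuple_mktuple => i.
  by case: (FP i).
rewrite -GP; congr G; apply: eq_from_tnth => i.
by rewrite tnth_mktuple [RHS]tnth_map tnth_mktuple (FP i).2.
Qed.

Lemma map_code_inj (R : pzRingType) (j : recursive_representation R) n :
  injective (map_tuple j : n.-tuple R -> n.-tuple nat).
Proof. by move=> u v /(congr1 val) /(inj_map (@code_inj _ j)) /val_inj. Qed.

(** The tuples of naturals that are codes of tuples of ring elements form a
    recursive set. *)
Lemma recursive_code_tuples (R : pzRingType) (j : recursive_representation R)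
    n :
  recursive_subset j (fun _ : n.-tuple R => True).
Proof.
have rS i : recursive_set (fun w : n.-tuple nat => exists x, tnth w i = j x).
  have rg : recursive_tuple (fun w : n.-tuple nat => [tuple tnth w i]).
    apply: recursive_tuple_cons (@recursive_tuple_nil n).
    exact: recursive_proj.
  exact: recursive_set_preimage (code_image j) rg.
apply: recursive_set_ext (recursive_set_forall rS) => w; split.
  move=> /fin_all_exists[x xP]; exists [tuple x i | i < n] => //.
  by apply: eq_from_tnth => i; rewrite tnth_map tnth_mktuple.
by case=> v _ -> i; exists (tnth v i); rewrite tnth_map.
Qed.

(** The recursive functions that compute terms on codes take arbitrary values
    elsewhere, so the code test is part of the decision procedure. *)
Lemma recursive_subset_holds (L : language) (R : pzRingType)
    (j : recursive_representation R) (I : interpretation L R) n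
    (f : basic_formula L n) :
  recursive_interpretation j I -> recursive_subset j (holds I f).
Proof.
move=> rI; case: f => k r ts.
have /fin_all_exists[F FP] : forall i, exists F, recursive_fun F /\
    forall e, F (map_tuple j e) = j (teval I e (ts i)).
  by move=> i; have [F rF FP] := recursive_op_teval (ts i) rI; exists F.
have rF : recursive_tuple (fun w => [tuple F i w | i < k]).
  by apply: recursive_tuple_mktuple => i; case: (FP i).
have FE e : [tuple F i (map_tuple j e) | i < k] =
    map_tuple j [tuple teval I e (ts i) | i < k].
  apply: eq_from_tnth => i.
  by rewrite tnth_mktuple [RHS]tnth_map tnth_mktuple (FP i).2.
apply: recursive_set_ext (recursive_setI (@recursive_code_tuples R j n)
  (recursive_set_preimage (rI.2 _ r) rF)) => w; split=> [[[e _ ->]]|[e he ->]].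
  by rewrite FE => -[u ru /map_code_inj eu]; exists e; rewrite //= eu.
by split; [exists e | rewrite FE; exists [tuple teval I e (ts i) | i < k]].
Qed.

Lemma recursive_subset_forall (R : pzRingType) (j : recursive_representation R)
    k n (S : 'I_n -> k.-tuple R -> Prop) :
  (forall i, recursive_subset j (S i)) ->
  recursive_subset j (fun e => forall i, S i e).
Proof.
move=> rS; apply: recursive_set_ext
  (recursive_setI (@recursive_code_tuples R j k) (recursive_set_forall rS)) => w.
split=> [[[e _ ->] Se]|[e Se ->]].
  by exists e => // i; have [u Su /map_code_inj->] := Se i.
by split=> [|i]; exists e.
Qed.

(** * Functions given by a Diophantine expression *)

Theorem lemma6p29 (R1 R2 : pzRingType)
    (j1 : recursive_representation R1) (j2 : recursive_representation R2)
    (L1 L2 : language) (I1 : interpretation L1 R1) (I2 : interpretation L2 R2)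
    (rI1 : recursive_interpretation j1 I1)
    (rI2 : recursive_interpretation j2 I2)
    (phi : R1 -> R2) (bij_phi : bijective phi)
    (rec_phi : recursive_map j1 j2 phi)
    (d : R1 -> R2) (dioph_d : diophantine_expression I2 phi d) :
  recursive_map j1 j2 d.
Proof.
have [n [l [f dP]]] := dioph_d; have [Phi rPhi PhiE] := rec_phi.
have [chi rchi chiP] := code_image j1.
have rH : recursive_subset j2 (fun e => forall i, holds I2 (f i) e).
  by apply: recursive_subset_forall => i; apply: recursive_subset_holds.
(* An argument tuple of the search lists the codes of y and z, then the input;
   env turns it into the codes of phi x, y, z. *)
pose last1 (u : (l + 2).-tuple nat) := [tuple tnth u (rshift l ord_max)].
pose env (u : (l + 2).-tuple nat) : l.+2.-tuple nat :=
  [tuple of Phi (last1 u) :: rcons [tuple tnth u (lshift 2 i) | i < l]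
                                  (tnth u (rshift l ord0))].
have rlast1 : recursive_tuple last1.
  by apply: recursive_tuple_cons (@recursive_tuple_nil _); apply: recursive_proj.
have renv : recursive_tuple env.
  apply: recursive_tuple_cons; first exact: recursive_comp rPhi rlast1.
  apply: recursive_tuple_rcons; last exact: recursive_proj.
  by apply: recursive_tuple_mktuple => i; apply: recursive_proj.
(* Outside the codes of R1 every y and z are accepted, so the search ends. *)
have rS := recursive_setU (recursive_setC (recursive_set_preimage (code_image j1)
  rlast1)) (recursive_set_preimage rH renv).
have catl (y : l.-tuple nat) z (v : 1.-tuple nat) :
    last1 [tuple of y ++ [tuple of z :: v]] = v.
  apply: eq_from_tnth => i; rewrite /last1 ord1 tnth0 tnth_rshift.
  by rewrite !(tnth_nth 0).
have cate (y : l.-tuple nat) z (v : 1.-tuple nat) :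
    env [tuple of y ++ [tuple of z :: v]] = [tuple of Phi v :: rcons y z].
  apply: val_inj; rewrite /env /= catl tnth_rshift tnth0; congr (_ :: rcons _ _).
  rewrite -[RHS]map_tnth_enum; apply: eq_map => i.
  by rewrite tnth_lshift.
have envE x (y : l.-tuple R2) z :
    [tuple of Phi [tuple j1 x] :: rcons (map_tuple j2 y) (j2 z)] =
    map_tuple j2 [tuple of phi x :: rcons y z].
  apply: val_inj; rewrite /= map_rcons; congr (_ :: _).
  by have := PhiE [tuple x]; rewrite theadE => <-; congr Phi; apply: val_inj.
have [v|F rF FP] := recursive_selection rS.
  have [chiv|Nchiv] := boolP (chi v); last first.
    exists [tuple of nseq l 0], 0; left; rewrite catl.
    by move=> /(proj1 (chiP _)); apply/negP.
  have /chiP[x vE] := chiv; have /dP[y yP] := erefl (d x).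
  exists (map_tuple j2 y), (j2 (d x)); right; rewrite cate.
  have -> : v = [tuple j1 x].
    by apply: eq_from_tnth => i; rewrite ord1 tnth0 -vE.
  by rewrite envE; exists [tuple of phi x :: rcons y (d x)].
exists F => // v; case/tupleP: v => x v; rewrite tuple0 theadE.
have -> : map_tuple j1 [tuple x] = [tuple j1 x] by apply: val_inj.
have [y []] := FP [tuple j1 x]; rewrite ?catl ?cate; first by case; exists x.
case=> -[[//|a e]]; case/lastP: e => [//|e z] ep he /(congr1 val) /= [PhiF].
rewrite map_rcons => /rcons_inj[_ Fz]; rewrite Fz; congr (j2 _); apply/esym/dP.
have se : size e == l by move: (ep); rewrite /= size_rcons !eqSS.
have phix : phi x = a.
  apply: (@code_inj _ j2); rewrite -PhiF.
  by have := PhiE [tuple x]; rewrite theadE => <-; congr Phi; apply: val_inj.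
exists (Tuple se) => i; have := he i; congr holds.
by apply: val_inj; rewrite /= phix.
Qed.
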